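(* For every $n,m\ge1$, the isolation-resilience of a synchronized communication system (SCS) whose communication graph is the $n\times m$ grid communication graph equals $n\cdot m-\min(n,m)-1$.
   Context: Model. A system consists of pairwise disjoint unit circles $C_1,\dots,C_N$ in the plane (trajectories) and a communication range $r>0$. Its communication graph $G$ has vertex set $\{C_1,\dots,C_N\}$, with $C_i,C_j$ adjacent iff the distance between their centres is at most $2+r$; $G$ is assumed connected. Positions on a circle are angles measured from the positive horizontal axis, modulo $2\pi$. For an edge $(i,j)$, the link position $\phi_{ij}$ is the angle of the point of $C_i$ closest to $C_j$. A schedule is a pair $F=(f,g)$ with $f(C_i)\in[0,2\pi)$, $g(C_i)\in\{1,-1\}$ ($1$ = counterclockwise); a robot following it on $C_i$ is at angle $f(C_i)+g(C_i)\cdot2\pi t$ at time $t$. $F$ is a synchronization schedule if $g(C_i)=-g(C_j)$ for every edge $(i,j)$ and robots following $F$ on adjacent $C_i,C_j$ are at $\phi_{ij}$ and $\phi_{ji}$ at exactly the same times. A synchronized communication system (SCS) consists of $N$ robots, initially one on each circle, following a synchronization schedule, with the switching rule: whenever a robot on $C_i$ reaches $\phi_{ij}$ at time $t$ and $C_j$ contains no robot, it instantly passes to $C_j$ and from then on follows the schedule of $C_j$; if $C_j$ contains a robot (then at $\phi_{ji}$), the two meet (exchange information) and each stays on its circle. A partial SCS is obtained by letting some robots leave (possibly at different times); remaining robots never leave. A surviving robot $u$ starves if every time $u$ arrives at a link position $\phi_{ij}$ of its current circle $C_i$, the circle $C_j$ is empty; the system is in starvation state if all surviving robots starve. The isolation-resilience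 of an SCS is the largest number $k$ such that, whichever $k$ robots leave, the system does not fall into starvation state. Grid. The $n\times m$ grid communication graph consists of $nm$ unit circles, circle $(i,j)$ in row $i$ (rows horizontal, row 1 on top) and column $j$ (columns vertical, column 1 on the left), centres on a square lattice, circle $(i,j)$ adjacent exactly to the existing circles $(i\pm1,j)$, $(i,j\pm1)$. *)

(* Defs.v *)
From mathcomp Require Import all_boot.
From Stdlib Require Import Reals ZArith.
Set Implicit Arguments. Unset Strict Implicit. Unset Printing Implicit Defensive.
Local Open Scope R_scope.

Definition eucl_dist (p q : R * R) : R :=
  sqrt ((p.1 - q.1) * (p.1 - q.1) + (p.2 - q.2) * (p.2 - q.2))%R.

(* [link_angle ci cj th]: th in [0,2pi) is the angle (on the unit circle
   centred at ci) of the point of that circle closest to the disjoint unit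
   circle centred at cj, i.e. the point in the direction of cj - ci. *)
Definition link_angle (ci cj : R * R) (th : R) : Prop :=
  (0 <= th < 2 * PI)%R /\
  cos th = ((cj.1 - ci.1) / eucl_dist ci cj)%R /\
  sin th = ((cj.2 - ci.2) / eucl_dist ci cj)%R.

(* V = circles, adj = communication graph, phi i j = link position.    *)
(* Robots are named by their initial circle (type V).                  *)
Section SCS.
Variable V : finType.
Variable adj : rel V.
Variable phi : V -> V -> R.

Definition at_angle (x th : R) : Prop := exists z : Z, x = (th + 2 * PI * IZR z)%R.

Definition pos (f g : V -> R) (v : V) (t : R) : R := (f v + g v * (2 * PI * t))%R.

Definition sync_schedule (f g : V -> R) : Prop :=
  (forall v, 0 <= f v < 2 * PI)%R /\
  (forall v, g v = 1%R \/ g v = (-1)%R) /\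
  (forall i j, adj i j ->
     g i = (- g j)%R /\
     forall t, at_angle (pos f g i t) (phi i j) <-> at_angle (pos f g j t) (phi j i)).

Definition active (f g : V -> R) (t : R) (i j : V) : Prop :=
  adj i j /\ at_angle (pos f g i t) (phi i j).

Definition event (f g : V -> R) (t : R) : Prop := exists i j, active f g t i j.

(* occupancy: c v = Some u iff robot u is on circle v *)
Definition config := V -> option V.
Definition init_config : config := fun v => Some v.

Definition departs (S : {set V}) (d : V -> R) (s t : R) (u : V) : bool :=
  (u \in S) &&
  (if Rlt_dec s (d u) then (if Rle_dec (d u) t then true else false) else false).

Definition remove_departed (S : {set V}) (d : V -> R) (s t : R) (c : config) : config :=
  fun v => match c v with
           | Some u => if departs S d s t u then None else Some u
           | None => None
           end.

(* switching rule applied at time t: c = configuration just before t,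
   c' = configuration just after the events at time t *)
Definition step_rel (f g : V -> R) (t : R) (c c' : config) : Prop :=
  forall v,
    ((forall w, active f g t v w -> (c v == None) = (c w == None)) -> c' v = c v) /\
    (forall w, active f g t v w -> (c v == None) != (c w == None) -> c' v = c w).

(* st t = configuration at time t (after departures and events at time t) *)
Definition is_run (f g : V -> R) (S : {set V}) (d : V -> R) (st : R -> config) : Prop :=
  st 0%R = init_config /\
  forall s t, (0 <= s)%R -> (s < t)%R ->
    (forall x, (s < x < t)%R -> ~ event f g x) ->
    step_rel f g t (remove_departed S d s t (st s)) (st t).

Definition falls_into_starvation (f g : V -> R) (S : {set V}) (d : V -> R)
    (st : R -> config) : Prop :=
  exists T : R, forall s t, (T < s)%R -> (s < t)%R ->
    (forall x, (s < x < t)%R -> ~ event f g x) ->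
    forall i j u, active f g t i j ->
      remove_departed S d s t (st s) i = Some u -> u \notin S ->
      remove_departed S d s t (st s) j = None.

Definition resilient_to (f g : V -> R) (k : nat) : Prop :=
  forall S : {set V}, #|S| = k ->
  forall d : V -> R, (forall u, u \in S -> (0 < d u)%R) ->
  forall st, is_run f g S d st -> ~ falls_into_starvation f g S d st.

(* k is the largest number in {0..N} with [resilient_to]; k = -1 if none *)
Definition isolation_resilience_is (f g : V -> R) (k : Z) : Prop :=
  ((0 <= k)%Z -> resilient_to f g (Z.to_nat k)) /\
  (forall j : nat, (k < Z.of_nat j)%Z -> (j <= #|V|)%nat -> ~ resilient_to f g j).

End SCS.

(* The n x m grid. Circle (i,j) (0-based: row i, column j), row 0 on top *)
Definition grid_adj (n m : nat) : rel ('I_n * 'I_m) :=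
  fun u v =>
    ((u.1 == v.1 :> nat) && (((u.2 : nat).+1 == v.2) || ((v.2 : nat).+1 == u.2))) ||
    ((u.2 == v.2 :> nat) && (((u.1 : nat).+1 == v.1) || ((v.1 : nat).+1 == u.1))).

Definition grid_center (n m : nat) (dd : R) (u : 'I_n * 'I_m) : R * R :=
  (INR u.2 * dd, - (INR u.1 * dd))%R.

(* Main.v *)
(* Reflecting every other column horizontally and every other row vertically makes all
   robots of a grid schedule move in phase, so links are active only at quarter periods,
   and then alternately between neighbouring columns and between neighbouring rows, each
   time along a matching.  Follow "slots" that always cross an active link; they carry the
   occupancy, because two robots that meet may as well be thought of as exchanging names.
   The row of a slot evolves independently of its column, so two slots of a common row
   share their row forever, and their columns, which perform billiard motion on a path,
   must cross.  Hence the surviving slots never meet iff their initial circles form a rook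
   placement, and the largest rook placement has min(n, m) elements. *)
Require Import Defs.
From mathcomp Require Import all_boot.
From Stdlib Require Import Reals ZArith.
From mathcomp Require Import zify.
From Stdlib Require Import Lra.
Set Implicit Arguments. Unset Strict Implicit. Unset Printing Implicit Defensive.

(** * Slots of a system whose events are matchings at regular times *)

(** The position, after events [E], ..., [E + T - 1], of the slot at [v]. Here [mu e] is the
    matching of links active at event [e], with unmatched circles as fixed points. *)
Fixpoint flow (A : Type) (mu : nat -> A -> A) (E T : nat) (v : A) : A :=
  if T is T'.+1 then mu (E + T') (flow mu E T' v) else v.

(** The initial circle of the slot found at [v] just before event [e]: for involutions, tracing back
    means applying the same matchings in reverse order. *)
Fixpoint origin (A : Type) (mu : nat -> A -> A) (e : nat) (v : A) : A :=
  if e is e'.+1 then origin mu e' (mu e' v) else v.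

Lemma flow_inj (A : Type) (mu : nat -> A -> A) E T :
  (forall e, injective (mu e)) -> injective (flow mu E T).
Proof. by move=> mu_inj; elim: T => [|T IH] x y //= /mu_inj /IH. Qed.

Lemma origin_inj (A : Type) (mu : nat -> A -> A) e :
  (forall e, injective (mu e)) -> injective (origin mu e).
Proof. by move=> mu_inj; elim: e => [|e IH] x y //= /IH /mu_inj. Qed.

(** A full turn takes one unit of time, so quarter turns are 1/4 apart. *)
Definition tick (t0 : R) (e : nat) : R := (t0 + INR e / 4)%R.

Lemma tick_lt t0 a b : (tick t0 a < tick t0 b)%R <-> a < b.
Proof.
rewrite /tick; split=> [h|/ltP /lt_INR]; last by lra.
by apply/ltP/INR_lt; lra.
Qed.

Lemma tick_ge t0 e : (t0 <= tick t0 e)%R.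
Proof. by rewrite /tick; have := pos_INR e; lra. Qed.

Lemma tick_inj t0 : injective (tick t0).
Proof. by rewrite /tick => a b h; apply: INR_eq; lra. Qed.

(** The number of ticks up to and including [t]: [up] is the least integer strictly above its
    argument, and [Z.to_nat] gives 0 before [t0]. *)
Definition ticks (t0 t : R) : nat := Z.to_nat (up (4 * (t - t0))).

Lemma ticksP t0 t e : e < ticks t0 t <-> (tick t0 e <= t)%R.
Proof.
rewrite /ticks /tick INR_IZR_INZ; have [hu1 hu2] := archimed (4 * (t - t0)).
split=> [h|h].
  have /IZR_le : (Z.of_nat e + 1 <= up (4 * (t - t0)))%Z by lia.
  by rewrite plus_IZR; lra.
have : (IZR (Z.of_nat e) < IZR (up (4 * (t - t0))))%R by lra.
by move/lt_IZR; lia.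
Qed.

Section Clock.
Variables (V : finType) (adj : rel V) (phi : V -> V -> R) (f g : V -> R).
Variables (t0 : R) (mu : nat -> V -> V).
Hypothesis t0_gt0 : (0 < t0)%R.
Hypothesis muK : forall e, involutive (mu e).
Hypothesis activeP : forall t i j, (0 < t)%R ->
  active adj phi f g t i j <-> exists e, [/\ t = tick t0 e, j = mu e i & j <> i].

Local Notation tick := (tick t0).
Local Notation ticks := (ticks t0).

Lemma active_tick e i j :
  active adj phi f g (tick e) i j <-> j = mu e i /\ j <> i.
Proof.
rewrite activeP; last by have := tick_ge t0 e; lra.
by split=> [[e' [/tick_inj <-]]|[]] //; exists e.
Qed.

Lemma event_tick t : (0 < t)%R -> event adj phi f g t -> exists e, t = tick e.
Proof. by move=> t_gt0 [i [j /(activeP _ _ t_gt0) [e []]]]; exists e. Qed.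

Lemma step_tick e (c c' : config V) :
  step_rel adj phi f g (tick e) c c' <->
  forall v, c' v = if (c v == None) == (c (mu e v) == None) then c v else c (mu e v).
Proof.
split=> [h v|h v].
  have [h1 h2] := h v; have [mv|mv] := eqVneq (mu e v) v.
    by rewrite mv eqxx; apply: h1 => w /active_tick [-> /(_ mv)].
  have act : active adj phi f g (tick e) v (mu e v).
    by apply/active_tick; split=> //; apply/eqP.
  case: ifPn => occ; last exact: h2.
  by apply: h1 => w /active_tick [-> _]; exact: (eqP occ).
split=> [h1|w /active_tick [-> _] ne]; last by rewrite h (negbTE ne).
rewrite h; have [mv|mv] := eqVneq (mu e v) v; first by rewrite mv eqxx.
by rewrite (h1 (mu e v)) ?eqxx //; apply/active_tick; split=> //; apply/eqP.
Qed.

Lemma step_idle t (c c' : config V) : (0 < t)%R -> (forall e, t <> tick e) ->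
  c' =1 c -> step_rel adj phi f g t c c'.
Proof.
move=> t_gt0 nt cc v; split=> [_|w act]; first exact: cc.
by have [e /nt] := event_tick t_gt0 (ex_intro _ v (ex_intro _ w act)).
Qed.

(** * Slots of the survivors in a starving run *)

Section Run.
Variables (S : {set V}) (d : V -> R) (st : R -> config V).
Hypothesis d_gt0 : forall u, u \in S -> (0 < d u)%R.
Hypothesis run_st : is_run adj phi f g S d st.

(** The start of the event-free interval that ends at tick [e], so [st (epoch e)] is the
    configuration after events 0, ..., [e - 1]. *)
Definition epoch (e : nat) : R := if e is e'.+1 then tick e' else 0%R.

Local Notation removed e := (remove_departed S d (epoch e) (tick e) (st (epoch e))).

Lemma epoch_ge0 e : (0 <= epoch e)%R.
Proof. by case: e => [|e] /=; [lra|have := tick_ge t0 e; lra]. Qed.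

Lemma epoch_lt e : (epoch e < tick e)%R.
Proof. by case: e => [|e] /=; [have := tick_ge t0 0; lra|apply/tick_lt]. Qed.

Lemma epoch_quiet e x : (epoch e < x < tick e)%R -> ~ event adj phi f g x.
Proof.
move=> [ex xt] /event_tick; have := epoch_ge0 e => e0.
case=> [|e' xe]; first by lra.
move: xt ex; rewrite xe => /tick_lt; case: e {e0} => //= e he /tick_lt; lia.
Qed.

Lemma epochS e v : st (epoch e.+1) v =
  if (removed e v == None) == (removed e (mu e v) == None)
  then removed e v else removed e (mu e v).
Proof.
apply/(step_tick e (removed e)): v; apply: (proj2 run_st).
- exact: epoch_ge0.
- exact: epoch_lt.
- exact: epoch_quiet.
Qed.

Lemma removed_some e v u : removed e v = Some u ->
  st (epoch e) v = Some u /\ ~~ departs S d (epoch e) (tick e) u.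
Proof. by rewrite /remove_departed; case: (st _ v) => // w; case: ifPn => // h [<-]. Qed.

Lemma survivor_present u e : u \notin S -> exists v, st (epoch e) v = Some u.
Proof.
move=> uS; elim: e => [|e [v hv]]; first by exists u; rewrite (proj1 run_st).
have rv : removed e v = Some u by rewrite /remove_departed hv /departs (negbTE uS).
case: (boolP ((removed e v == None) == (removed e (mu e v) == None))) => h.
  by exists v; rewrite epochS h.
by exists (mu e v); rewrite epochS muK eq_sym (negbTE h).
Qed.

Lemma departed_absent u e v : u \in S -> (d u <= epoch e)%R -> st (epoch e) v <> Some u.
Proof.
move=> uS; elim: e v => [|e IH] v; first by have := d_gt0 uS; rewrite /=; lra.
move=> du; have absent w : removed e w <> Some u.
  move=> /removed_some [hw]; rewrite /departs uS /=.
  case: Rlt_dec => hlt; last by move=> _; apply: (IH w) hw; lra.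
  by case: Rle_dec.
by rewrite epochS; case: ifP => _; apply: absent.
Qed.

(** Late enough, departures are over and starvation has set in. Slots started on the survivors'
    circles stay occupied from then on, so two distinct ones facing each other across an active link
    would be a meeting. *)
Lemma starved_slots : falls_into_starvation adj phi f g S d st ->
  exists E (slot : V -> V), {in ~: S &, injective slot} /\
  forall T u w, u \notin S -> w \notin S ->
    mu (E + T) (flow mu E T (slot u)) = flow mu E T (slot w) ->
    flow mu E T (slot u) = flow mu E T (slot w).
Proof.
case=> T0 starve.
have [M hM] : exists M, forall u, u \in enum V -> (d u <= M)%R.
  elim: (enum V) => [|a s [M hM]]; first by exists 0%R.
  exists (Rmax (d a) M) => u; rewrite inE => /orP [/eqP ->|/hM h].
    exact: Rmax_l.
  exact: Rle_trans h (Rmax_r _ _).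
(* The successor makes [epoch E] the first tick strictly after all departures and after the
   starvation threshold. *)
pose E := (ticks (Rmax M T0)).+1.
have hE e : E <= e -> (Rmax M T0 < epoch e)%R.
  case: e => //= e; rewrite ltnNge => he; apply: Rnot_le_lt => /ticksP; lia.
have alive e v u : E <= e -> st (epoch e) v = Some u -> u \notin S.
  move=> /hE he hv; apply/negP => uS; apply: (departed_absent uS) hv.
  by have := hM u (mem_enum _ _); have := Rmax_l M T0; lra.
have keep e v : E <= e -> removed e v = st (epoch e) v.
  move=> he; rewrite /remove_departed; case hv: (st _ v) => [u|] //.
  by rewrite /departs (negbTE (alive _ _ _ he hv)).
(* Occupancy follows the matching: either the robot crosses, or the partner circle holds a robot
   that stays there. *)
have occS e v : E <= e -> st (epoch e) v <> None -> st (epoch e.+1) (mu e v) <> None.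
  by move=> he; rewrite epochS muK !keep //; case: (st _ v); case: (st _ (mu e v)).
have occF T v : st (epoch E) v <> None -> st (epoch (E + T)) (flow mu E T v) <> None.
  by elim: T => [|T IH] hv; rewrite ?addn0 // addnS; apply: occS; [lia|exact: IH].
(* The slot of a survivor starts where the survivor is at [epoch E]; the default [u] is reached only
   by departed robots. *)
exists E, (fun u => odflt u [pick v | st (epoch E) v == Some u]).
have slotP u : u \notin S ->
    st (epoch E) (odflt u [pick v | st (epoch E) v == Some u]) = Some u.
  move=> /(survivor_present E) [v hv]; case: pickP => [w /eqP //|/(_ v)].
  by rewrite hv eqxx.
split=> [u w|T u w uS wS].
  rewrite !inE => uS wS eq_slot; have := slotP _ uS.
  by rewrite eq_slot slotP // => [[->]].
set x := flow _ _ _ _; set y := flow _ _ _ _ => xy.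
have [//|/eqP nxy] := eqVneq x y.
have [he oc] : E <= E + T /\ st (epoch (E + T)) x <> None.
  by split; [lia|apply: occF; rewrite slotP].
have ocy : st (epoch (E + T)) y <> None by apply: occF; rewrite slotP.
case hx: (st (epoch (E + T)) x) oc => [z|] // _.
case: ocy; rewrite -keep //.
apply: (starve _ _ _ (epoch_lt _) _ x y z) => //.
- by have := hE _ he; have := Rmax_r M T0; lra.
- exact: epoch_quiet.
- by apply/active_tick; split=> // yx; apply: nxy.
- by rewrite keep.
- exact: alive hx.
Qed.

End Run.

(** * A starving run for slots that never meet *)

Section Extinction.
Variable X : {set V}.
Hypothesis X_free : forall e v,
  origin mu e v \in X -> origin mu e (mu e v) \in X -> mu e v = v.

(* All of [~: X] leaves at time [t0], which counts as before the first event. *)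
Definition survivors (e : nat) : config V :=
  fun v => let u := origin mu e v in if u \in X then Some u else None.

Definition thinned (t : R) : config V :=
  if Rlt_dec t t0 then @init_config V else survivors (ticks t).

Local Notation departure := (fun _ : V => t0).

Lemma survivorsS e v : survivors e.+1 v = survivors e (mu e v).
Proof. by []. Qed.

Lemma survivors_meet e v : survivors e v <> None -> survivors e (mu e v) <> None -> mu e v = v.
Proof. by rewrite /survivors; do 2!case: ifP => // ?; move=> _ _; apply: X_free. Qed.

Lemma remove_thinned s t : (0 <= s < t)%R -> (t0 <= t)%R ->
  remove_departed (~: X) departure s t (thinned s) =1 survivors (ticks s).
Proof.
move=> st tt v; rewrite /remove_departed /thinned /departs /=.
case: Rlt_dec => h.
- have -> : ticks s = 0.
    apply/eqP; rewrite -leqn0 leqNgt; apply/negP => /ticksP.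
    by have := tick_ge t0 0; lra.
  rewrite /init_config /survivors /= inE; case: (Rle_dec t0 t) => [le|] //=.
  by rewrite andbT; case: (v \in X).
- by rewrite /=; case: (survivors _ v) => [u|] //; rewrite andbF.
Qed.

(** An event-free interval may still contain ticks whose matching is trivial, such as the vertical
    ticks of a one-row grid; these move no slot. *)
Lemma survivors_quiet s t b : (0 <= s)%R ->
  (forall x, (s < x < t)%R -> ~ event adj phi f g x) ->
  ticks s <= b -> (forall e, e < b -> (tick e < t)%R) ->
  survivors (ticks s) =1 survivors b.
Proof.
move=> s0 quiet; elim: b => [|b IH]; first by rewrite leqn0 => /eqP ->.
rewrite leq_eqVlt => /orP [/eqP -> //|sb] hb v.
rewrite survivorsS -IH // => [|e eb]; last by apply: hb; lia.
have [-> //|/eqP mv] := eqVneq (mu b v) v.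
case: (quiet (tick b)).
  by split; [apply: Rnot_le_lt => /ticksP; lia|exact: hb].
by exists v, (mu b v); apply/active_tick.
Qed.

Lemma survivors_at_tick s b : (0 <= s)%R ->
  (forall x, (s < x < tick b)%R -> ~ event adj phi f g x) -> (s < tick b)%R ->
  survivors (ticks s) =1 survivors b.
Proof.
move=> s0 quiet sb; apply: (survivors_quiet s0 quiet).
  by rewrite leqNgt; apply/negP => /ticksP; lra.
by move=> e /tick_lt.
Qed.

(** By [X_free] a robot of [X] always finds its partner circle empty and crosses. It therefore stays
    on its slot, and its name is the [origin] of that slot. *)
Lemma thinned_run : is_run adj phi f g (~: X) departure thinned.
Proof.
split=> [|s t s0 lt_st quiet]; first by rewrite /thinned; case: Rlt_dec.
have [lt_t0|le_t0] := Rlt_le_dec t t0.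
  apply: step_idle; first by lra.
    by move=> e; have := tick_ge t0 e; lra.
  move=> v; rewrite /thinned /remove_departed /departs /init_config.
  do 2![case: Rlt_dec => ?; last by lra].
  by case: Rle_dec => ? /=; [lra|rewrite andbF].
have rem := remove_thinned (conj s0 lt_st) le_t0.
have -> : thinned t = survivors (ticks t) by rewrite /thinned; case: Rlt_dec => // ?; lra.
have lt_ticks e : e < ticks t -> t <> tick e -> (tick e < t)%R by move/ticksP; lra.
have [[b tb]|ntick] : (exists b, t = tick b) \/ (forall b, t <> tick b).
  (* Only the last tick counted by [ticks t] can equal [t]. *)
  have [k htick] : exists k, k = ticks t by exists (ticks t).
  case: k htick => [|k] htick.
    right=> b tb; have /ticksP : (tick b <= t)%R by lra.
    by rewrite -htick.
  case: (Req_dec t (tick k)) => ht; [by left; exists k|right=> b tb].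
  have /ticksP : (tick b <= t)%R by lra.
  rewrite -htick ltnS leq_eqVlt => /orP [/eqP bk|/(tick_lt t0) bk].
    by rewrite -bk in ht.
  have /ticksP kt : k < ticks t by rewrite -htick.
  by lra.
- have -> : ticks t = b.+1.
    apply/eqP; rewrite eqn_leq; apply/andP; split.
      by rewrite leqNgt; apply/negP => /ticksP; rewrite tb => /Rle_not_lt; apply; apply/tick_lt.
    by apply/ticksP; lra.
  subst t; have sv := survivors_at_tick s0 quiet lt_st.
  apply/step_tick => v; rewrite !rem !sv survivorsS.
  have [->|/eqP mv] := eqVneq (mu b v) v; first by rewrite eqxx.
  case hv: (survivors b v) => [u|]; case hw: (survivors b (mu b v)) => [w|] //=.
  by case: mv; apply: survivors_meet; rewrite ?hv ?hw.
- apply: step_idle; [lra|exact: ntick|move=> v; rewrite rem; apply/esym].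
  apply: (survivors_quiet s0 quiet); last by move=> e /lt_ticks; apply.
  by case E: (ticks s) => [//|k]; apply/ticksP; have /ticksP : k < ticks s by [rewrite E]; lra.
Qed.

Lemma thinned_starves : falls_into_starvation adj phi f g (~: X) departure thinned.
Proof.
exists t0 => s t hs lt_st quiet i j u act.
have t_gt0 : (0 < t)%R by lra.
have /(activeP _ _ t_gt0) [b [tb -> ne]] := act.
have s0 : (0 <= s)%R by lra.
rewrite !remove_thinned //; try lra; subst t.
rewrite !(survivors_at_tick s0 quiet lt_st) => hi _.
case hj: (survivors b (mu b i)) => [w|] //.
by case: ne; apply: survivors_meet; rewrite ?hi ?hj.
Qed.

Lemma not_resilient_free : ~ resilient_to adj phi f g #|~: X|.
Proof.
move=> /(_ (~: X) erefl departure (fun _ _ => t0_gt0) thinned thinned_run).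
by apply; exact: thinned_starves.
Qed.

End Extinction.
End Clock.

(** * Alternating swaps on a path *)

(** [Some p] swaps [c] and [c.+1] for every [c] of parity [p], and [None] is a pause. An end without
    partner stays put; at 0 this relies on [0.-1 = 0]. *)
Definition slide (m : nat) (o : option bool) (c : nat) : nat :=
  if o is Some p then
    if odd c == p then (if c.+1 < m then c.+1 else c) else c.-1
  else c.

Lemma slide_lt m o c : c < m -> slide m o c < m.
Proof. by case: o => [p|] //= hc; case: ifP => _; [case: ifP|lia]. Qed.

Lemma slideK m o c : c < m -> slide m o (slide m o c) = c.
Proof.
case: o => [p|] //= hc; have [hp|hp] := eqVneq (odd c) p.
  case: (ltnP c.+1 m) => hc'; last by rewrite hp eqxx ltnNge hc'.
  rewrite /= -hp. by case: (odd c).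
case: c hc hp => [|c] hc /= hp; first by rewrite (negbTE hp).
by move: hp; rewrite hc; case: (odd c); case: (p).
Qed.

(* Billiard motion on the path 0, ..., m-1 unfolds to a rotation of the cycle Z/2m:
   coordinates x >= m stand for column 2m-1-x met on the way back. *)
Definition fold (m x : nat) : nat :=
  let y := x %% m.*2 in if y < m then y else m.*2 - y.+1.

Lemma fold_small m x : x < m -> fold m x = x.
Proof. by move=> xm; rewrite /fold modn_small ?xm //; lia. Qed.

Lemma fold_large m x : m <= x < m.*2 -> fold m x = m.*2 - x.+1.
Proof. by move=> /andP [mx xm]; rewrite /fold modn_small // ltnNge mx. Qed.

Lemma fold_period m x : fold m (x + m.*2) = fold m x.
Proof. by rewrite /fold modnDr. Qed.

(** For [y < m] the column is [y] and the swap moves it right; afterwards the column [2m-1-y] has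
    the opposite parity, so it moves left. At each end the slot pauses for one swap while the
    coordinate advances. Parity survives reduction because the cycle length is even. *)
Lemma slide_fold m x : 0 < m -> slide m (Some (odd x)) (fold m x) = fold m x.+1.
Proof.
move=> m0; pose y := x %% m.*2.
have ym : y < m.*2 by rewrite ltn_mod; lia.
have yx : odd y = odd x.
  by rewrite [in RHS](divn_eq x m.*2) oddD oddM odd_double andbF.
have foldy z : fold m (z + x) = fold m (z + y) by rewrite /fold modnDmr.
rewrite -(add0n x) foldy -addSn foldy add0n add1n -yx.
have [ym'|ym'] := ltnP y m.
  rewrite fold_small //= eqxx; case: ifP => h; first by rewrite fold_small.
  by rewrite fold_large; lia.
rewrite fold_large /= ?ym' //.
have -> : (odd (m.*2 - y.+1) == odd y) = false by lia.
have [ylast|ylast] := eqVneq y.+1 m.*2.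
  by rewrite ylast subnn /fold modnn m0.
by rewrite fold_large; lia.
Qed.

(** A direction is active at every second event, each time with the other parity of swaps. *)
Definition alternating (mv : nat -> option bool) : Prop :=
  forall e, if mv e is Some p then mv e.+1 = None /\ mv e.+2 = Some (~~ p)
            else mv e.+1 <> None.

Local Notation track m mv := (flow (fun e => slide m (mv e))).

(** Two events advance the unfolded coordinate by one, and its parity keeps agreeing with that of
    the next swap. *)
Lemma flow_fold m mv E x T : 0 < m -> alternating mv -> mv E = Some (odd x) ->
  mv (E + T.*2) = Some (odd (x + T)) /\
  track m mv E T.*2 (fold m x) = fold m (x + T).
Proof.
move=> m0 alt hE; elim: T => [|T [mvT IH]]; first by rewrite !addn0 hE.
have := alt (E + T.*2); rewrite mvT => -[mv1 mv2].
rewrite doubleS !addnS mv2; split=> //=.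
by rewrite addnS mv1 /= mvT IH slide_fold.
Qed.

(** Both unfolded coordinates rotate at the same speed, so their gap is constant; when one has
    turned back at column 0 and the other has not, they pass each other in a swap. *)
Lemma slides_meet_now m mv E a b : alternating mv -> mv E <> None ->
  a < m -> b < m -> a <> b ->
  exists T, mv (E + T) <> None /\
    slide m (mv (E + T)) (track m mv E T a) = track m mv E T b.
Proof.
move=> alt; case mvE: (mv E) => [p|] // _ am bm ab.
have m0 : 0 < m by lia.
(* The two coordinates over a column have opposite parities; the one matching the current swap is
   chosen. *)
have unfold c : c < m -> exists x, [/\ x < m.*2, odd x = p & fold m x = c].
  move=> cm; case: (eqVneq (odd c) p) => hc.
    by exists c; rewrite fold_small //; split=> //; lia.
  by exists (m.*2 - c.+1); rewrite fold_large; [split|]; lia.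
have [x [xm xp xa]] := unfold a am; have [y [ym yp yb]] := unfold b bm.
have {ab} : x <> y by move=> xy; apply: ab; rewrite -xa -yb xy.
rewrite -{a am}xa -{b bm}yb.
(* Exchanging the two tracks is harmless because [slide] is an involution. *)
wlog : x y xm ym xp yp / x < y => [wl|xy _].
  move=> nxy; have [xy|yx] := ltnP x y; first exact: wl.
  have {}yx : y < x by lia.
  have [T [mvT meet]] := wl y x ym xm yp xp yx (fun e => nxy (esym e)).
  exists T; split=> //=; rewrite -meet slideK //.
  have foldm : fold m y < m.
    by rewrite /fold modn_small //; case: ifP => //; lia.
  by elim: (T) => [//|T' IH] /=; apply: slide_lt.
(* At this time the tracks are symmetric about the turning point 2m - 1/2. *)
pose del := (y - x)./2; pose T := m.*2 - 1 - x - del.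
have xE : x + T = m.*2 - del.+1 by lia.
have yE : y + T = del.-1 + m.*2 by lia.
have [mvT fx] := flow_fold T m0 alt (etrans mvE (congr1 Some (esym xp))).
have [_ fy] := flow_fold T m0 alt (etrans mvE (congr1 Some (esym yp))).
exists T.*2; rewrite mvT; split=> //=.
(* The tracks are now in columns [del] and [del.-1], with [del > 0] since [x] and [y] have equal
   parity. *)
rewrite fx fy xE yE fold_period (@fold_small _ del.-1); last by lia.
rewrite fold_large; last by lia.
have -> : m.*2 - (m.*2 - del.+1).+1 = del by lia.
by rewrite ifN //; lia.
Qed.

Lemma flowS_shift (A : Type) (mu : nat -> A -> A) E T v :
  flow mu E T.+1 v = flow mu E.+1 T (mu E v).
Proof. by elim: T => [|T IH] /=; rewrite ?addn0 // -IH /= addSnnS. Qed.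

Lemma slides_meet m mv E a b : alternating mv -> a < m -> b < m -> a <> b ->
  exists T, mv (E + T) <> None /\
    slide m (mv (E + T)) (track m mv E T a) = track m mv E T b.
Proof.
move=> alt am bm ab; case mvE: (mv E) => [p|].
  by apply: slides_meet_now => //; rewrite mvE.
have := alt E; rewrite mvE => mvE1.
have [T meet] := slides_meet_now alt mvE1 am bm ab.
by exists T.+1; rewrite !flowS_shift mvE -addSnnS.
Qed.

Lemma slideP m p c c' : c < m -> c' < m ->
  c' = slide m (Some p) c /\ c' <> c <->
  (c' = c.+1 /\ odd c = p) \/ (c = c'.+1 /\ odd c' = p).
Proof.
move=> cm cm' /=; have [hp|hp] := eqVneq (odd c) p; [case: ifP => h|]; lia.
Qed.

(** * Link events of the grid *)

(** If the cosines and sines agree, then [cos (x - y) = 1], so the sine of the half difference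
    vanishes. *)
Lemma at_angleE x y : at_angle x y <-> cos x = cos y /\ sin x = sin y.
Proof.
split=> [[z ->]|[hc hs]].
  have -> : (y + 2 * PI * IZR z = y + 2 * (IZR z * PI))%R by ring.
  have hs : sin (IZR z * PI) = 0%R by apply: sin_eq_0_1; exists z.
  by rewrite cos_plus sin_plus cos_2a_sin sin_2a hs; split; ring.
have c1 : cos (x - y) = 1%R.
  by rewrite cos_minus hc hs Rplus_comm; exact: sin2_cos2.
have half : (x - y = 2 * ((x - y) / 2))%R by field.
rewrite half cos_2a_sin in c1.
have /sin_eq_0_0 [k hk] : sin ((x - y) / 2) = 0%R by nra.
by exists k; nra.
Qed.

Definition sgn (b : bool) : R := if b then (-1)%R else 1%R.

Lemma sgnN b : sgn (~~ b) = (- sgn b)%R.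
Proof. by case: b; rewrite /sgn /=; lra. Qed.

Lemma sgn_neq0 b : sgn b <> 0%R.
Proof. by case: b; rewrite /sgn; lra. Qed.

Lemma sgn_inj : injective sgn.
Proof. by case=> -[]; rewrite /sgn //; lra. Qed.

Lemma cos_sin_quarter k :
  cos (INR k * (PI / 2)) = (if odd k then 0 else sgn (odd k./2))%R /\
  sin (INR k * (PI / 2)) = (if odd k then sgn (odd k./2) else 0)%R.
Proof.
elim: k => [|k [IHc IHs]]; first by rewrite Rmult_0_l cos_0 sin_0.
rewrite S_INR Rmult_plus_distr_r Rmult_1_l cos_plus sin_plus IHc IHs cos_PI2 sin_PI2.
rewrite /= uphalf_half oddD; case: (odd k) => /=; rewrite ?sgnN; split; ring.
Qed.

(** * Grid schedules as reflections of the corner robot *)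

Section Clockwork.
Variables (n m : nat) (dd : R) (phi : 'I_n * 'I_m -> 'I_n * 'I_m -> R).
Variables (f g : 'I_n * 'I_m -> R) (o : 'I_n * 'I_m).
Hypotheses (o1 : o.1 = 0 :> nat) (o2 : o.2 = 0 :> nat).
Hypothesis dd_gt0 : (0 < dd)%R.
Hypothesis hphi : forall u v, grid_adj u v ->
  link_angle (grid_center dd u) (grid_center dd v) (phi u v).
Hypothesis hF : sync_schedule (@grid_adj n m) phi f g.

Local Notation V := ('I_n * 'I_m)%type.

(* Qualified because [Reals] also exports a [pos]. *)
Local Notation angle := (Defs.pos f g).

Definition right_of (u v : V) := (v.1 = u.1 :> nat) /\ (v.2 = u.2.+1 :> nat).
Definition below (u v : V) := (v.1 = u.1.+1 :> nat) /\ (v.2 = u.2 :> nat).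

Lemma grid_adjP (u v : V) : grid_adj u v <->
  [\/ right_of u v, right_of v u, below u v | below v u].
Proof.
rewrite /grid_adj /right_of /below; split.
  case/orP=> /andP [/eqP h /orP [] /eqP h'].
  - by apply: Or41; lia.
  - by apply: Or42; lia.
  - by apply: Or43; lia.
  - by apply: Or44; lia.
by case=> -[-> ->]; rewrite !eqxx ?orbT.
Qed.

Lemma eucl_dist_shift (p q : R * R) a b :
  (p.1 - q.1 = a)%R -> (p.2 - q.2 = b)%R -> (a * a + b * b = dd * dd)%R -> eucl_dist p q = dd.
Proof. by rewrite /eucl_dist => -> -> ->; apply: sqrt_square; lra. Qed.

Lemma link_right u v : right_of u v ->
  [/\ cos (phi u v) = 1%R, sin (phi u v) = 0%R,
      cos (phi v u) = (-1)%R & sin (phi v u) = 0%R].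
Proof.
move=> uv; have [h1 h2] := uv.
have /hphi [_ [-> ->]] : grid_adj u v by apply/grid_adjP; apply: Or41.
have /hphi [_ [-> ->]] : grid_adj v u by apply/grid_adjP; apply: Or42.
rewrite (@eucl_dist_shift (grid_center dd u) _ (- dd) 0);
  try by rewrite /grid_center /= ?h1 ?h2 ?S_INR; ring.
rewrite (@eucl_dist_shift (grid_center dd v) _ dd 0);
  try by rewrite /grid_center /= ?h1 ?h2 ?S_INR; ring.
by rewrite /grid_center /= h1 h2 ?S_INR; split; field; lra.
Qed.

Lemma link_below u v : below u v ->
  [/\ cos (phi u v) = 0%R, sin (phi u v) = (-1)%R,
      cos (phi v u) = 0%R & sin (phi v u) = 1%R].
Proof.
move=> uv; have [h1 h2] := uv.
have /hphi [_ [-> ->]] : grid_adj u v by apply/grid_adjP; apply: Or43.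
have /hphi [_ [-> ->]] : grid_adj v u by apply/grid_adjP; apply: Or44.
rewrite (@eucl_dist_shift (grid_center dd u) _ 0 dd);
  try by rewrite /grid_center /= ?h1 ?h2 ?S_INR; ring.
rewrite (@eucl_dist_shift (grid_center dd v) _ 0 (- dd));
  try by rewrite /grid_center /= ?h1 ?h2 ?S_INR; ring.
by rewrite /grid_center /= h1 h2 ?S_INR; split; field; lra.
Qed.

(* Neighbours turn in opposite directions, so the sum of their angles is constant. *)
Lemma pos_sum u v t : grid_adj u v ->
  exists z, (angle u t + angle v t = phi u v + phi v u + 2 * PI * IZR z)%R.
Proof.
move=> uv; have [_ [hg /(_ u v uv) [guv sync]]] := hF.
have gu : (g u * g u = 1)%R by case: (hg u) => ->; ring.
have PI0 : PI <> 0%R by have := PI_RGT_0; lra.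
(* A time at which [u] is at its link to [v], solved from the schedule with [g u] as its own
   inverse. *)
pose s := (g u * (phi u v - f u) / (2 * PI))%R.
have us : angle u s = phi u v.
  rewrite /Defs.pos /s.
  transitivity (f u + (g u * g u) * (phi u v - f u))%R; first by field.
  by rewrite gu; ring.
have [z vs] : at_angle (angle v s) (phi v u).
  by apply/sync; exists 0%Z; rewrite us; ring.
exists z; rewrite -us Rplus_assoc -vs /Defs.pos.
by rewrite guv; ring.
Qed.

(** The link angles are 0 and pi modulo 2 pi, so the two angles add up to pi: a mirror image in a
    vertical axis. *)
Lemma pos_right u v t : right_of u v ->
  cos (angle v t) = (- cos (angle u t))%R /\ sin (angle v t) = sin (angle u t).
Proof.
move=> uv; have [c1 s1 c2 s2] := link_right uv.
have /(pos_sum t) [z sum] : grid_adj u v by apply/grid_adjP; apply: Or41.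
have /at_angleE [hc hs] : at_angle (angle v t) (phi u v + phi v u - angle u t).
  by exists z; lra.
by rewrite hc hs cos_minus sin_minus cos_plus sin_plus c1 s1 c2 s2; split; ring.
Qed.

(** Here the link angles cancel modulo 2 pi, giving a mirror image in a horizontal axis. *)
Lemma pos_below u v t : below u v ->
  cos (angle v t) = cos (angle u t) /\ sin (angle v t) = (- sin (angle u t))%R.
Proof.
move=> uv; have [c1 s1 c2 s2] := link_below uv.
have /(pos_sum t) [z sum] : grid_adj u v by apply/grid_adjP; apply: Or43.
have /at_angleE [hc hs] : at_angle (angle v t) (phi u v + phi v u - angle u t).
  by exists z; lra.
by rewrite hc hs cos_minus sin_minus cos_plus sin_plus c1 s1 c2 s2; split; ring.
Qed.

(** Reflections compose along the top row from the corner [o], then down the column. *)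
Lemma pos_cos_sin u t :
  cos (angle u t) = (sgn (odd u.2) * cos (angle o t))%R /\
  sin (angle u t) = (sgn (odd u.1) * sin (angle o t))%R.
Proof.
case: u => i j /=.
have [i0 hi0] : exists i0 : 'I_n, i0 = 0 :> nat by exists o.1.
have row0 (j' : 'I_m) : cos (angle (i0, j') t) = (sgn (odd j') * cos (angle o t))%R /\
    sin (angle (i0, j') t) = sin (angle o t).
  case: j' => k /= hk; elim: k hk => [|k IH] hk.
    have -> : (i0, Ordinal hk) = o.
      by apply/eqP; rewrite [o]surjective_pairing xpair_eqE -!val_eqE /= hi0 o1 o2.
    by rewrite /sgn /=; split; ring.
  have hk' : k < m by lia.
  have [hc hs] := IH hk'.
  have [-> ->] := @pos_right (i0, Ordinal hk') (i0, Ordinal hk) t (conj erefl erefl).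
  by rewrite hc hs /= sgnN; split; ring.
case: i => k /= hk; elim: k hk => [|k IH] hk.
  have -> : Ordinal hk = i0 by apply: val_inj; rewrite /= hi0.
  by have [-> ->] := row0 j; rewrite /sgn /=; split; ring.
have hk' : k < n by lia.
have [hc hs] := IH hk'.
have [-> ->] := @pos_below (Ordinal hk', j) (Ordinal hk, j) t (conj erefl erefl).
by rewrite hc hs /= sgnN; split; ring.
Qed.

(** The cosine alone decides: once it is 1 or -1, the sine is 0. *)
Lemma active_right u v t : right_of u v ->
  (active (@grid_adj n m) phi f g t u v <-> cos (angle o t) = sgn (odd u.2)) /\
  (active (@grid_adj n m) phi f g t v u <-> cos (angle o t) = sgn (odd u.2)).
Proof.
move=> uv; have [c1 s1 c2 s2] := link_right uv.
have auv : grid_adj u v by apply/grid_adjP; apply: Or41.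
have avu : grid_adj v u by apply/grid_adjP; apply: Or42.
have [hc hs] := pos_cos_sin u t; have [hc' hs'] := pos_right t uv.
have unit := sin2_cos2 (angle o t); rewrite /Rsqr in unit.
rewrite /active !at_angleE c1 s1 c2 s2 hc' hs' hc hs.
by rewrite /sgn; case: (odd u.2); case: (odd u.1); split; split=> [[_ [hx hy]]|h];
  do ?split=> //; nra.
Qed.

Lemma active_below u v t : below u v ->
  (active (@grid_adj n m) phi f g t u v <-> sin (angle o t) = sgn (~~ odd u.1)) /\
  (active (@grid_adj n m) phi f g t v u <-> sin (angle o t) = sgn (~~ odd u.1)).
Proof.
move=> uv; have [c1 s1 c2 s2] := link_below uv.
have auv : grid_adj u v by apply/grid_adjP; apply: Or43.
have avu : grid_adj v u by apply/grid_adjP; apply: Or44.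
have [hc hs] := pos_cos_sin u t; have [hc' hs'] := pos_below t uv.
have unit := sin2_cos2 (angle o t); rewrite /Rsqr in unit.
rewrite /active !at_angleE c1 s1 c2 s2 hc' hs' hc hs.
by rewrite /sgn; case: (odd u.1); case: (odd u.2); split; split=> [[_ [hx hy]]|h];
  do ?split=> //; simpl in *; nra.
Qed.

(** Event [e] has the corner robot at quarter turn [a + e], counted in its direction of motion. Even
    quarter turns activate horizontal links, odd ones vertical links; [s] below records clockwise
    motion. *)
Definition col_move (a e : nat) : option bool :=
  if odd (a + e) then None else Some (odd (a + e)./2).

Definition row_move (s : bool) (a e : nat) : option bool :=
  if odd (a + e) then Some (~~ (s (+) odd (a + e)./2)) else None.

Definition oslide k (mv : option bool) (c : 'I_k) : 'I_k :=
  Ordinal (slide_lt mv (ltn_ord c)).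

(** The product form makes the row of a slot evolve independently of its column. *)
Definition grid_move (s : bool) (a e : nat) (u : V) : V :=
  (oslide (row_move s a e) u.1, oslide (col_move a e) u.2).

Lemma grid_moveK s a e : involutive (grid_move s a e).
Proof.
by case=> i j; apply/eqP; rewrite xpair_eqE -!val_eqE /= !slideK ?eqxx.
Qed.

Lemma clock : exists (t0 : R) (s : bool) (a : nat), (0 < t0)%R /\
  (forall e, cos (angle o (tick t0 e)) =
               (if odd (a + e) then 0 else sgn (odd (a + e)./2))%R /\
             sin (angle o (tick t0 e)) =
               (if odd (a + e) then sgn (s (+) odd (a + e)./2) else 0)%R) /\
  (forall t, (0 < t)%R -> (cos (angle o t) * sin (angle o t) = 0)%R ->
     exists e, t = tick t0 e).
Proof.
have PI0 := PI_RGT_0.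
have [/(_ o) [f0 f1] [/(_ o) hg _]] := hF.
(* The initial angle of [o] in quarter turns, measured in its direction of motion. *)
pose h := (g o * (2 * f o / PI))%R.
have h_gt : (-4 < h)%R.
  have : (0 <= 2 * f o / PI < 4)%R.
    split; first by apply: Rle_mult_inv_pos; lra.
    by apply: (Rmult_lt_reg_r PI) => //; field_simplify; lra.
  by rewrite /h; case: hg => ->; lra.
have [hu1 hu2] := archimed h.
have posE t : angle o t = (g o * ((h + 4 * t) * (PI / 2)))%R.
  by rewrite /Defs.pos /h; case: hg => ->; field; lra.
(* The first positive time at which the number of quarter turns is an integer, namely [up h]. Adding
   a full turn makes it a natural number, since [h > -4]. *)
pose t0 := ((IZR (up h) - h) / 4)%R; pose a := Z.to_nat (up h + 4).
have aE : INR a = (IZR (up h) + 4)%R.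
  rewrite INR_IZR_INZ Z2Nat.id ?plus_IZR //.
  by apply: le_IZR; rewrite plus_IZR; lra.
exists t0, (if Rlt_dec (g o) 0 then true else false), a; split; first by rewrite /t0; lra.
split=> [e|t t_gt0 cs0].
  have /at_angleE [-> ->] : at_angle (angle o (tick t0 e)) (g o * (INR (a + e) * (PI / 2))).
    rewrite plus_INR aE posE /tick /t0.
    case: hg => ->; [exists (-1)%Z|exists 1%Z]; field.
  have [hc hs] := cos_sin_quarter (a + e).
  case: hg => ->; case: Rlt_dec => ?; try lra.
    by rewrite Rmult_1_l hc hs.
  have -> : (-1 * (INR (a + e) * (PI / 2)) = - (INR (a + e) * (PI / 2)))%R by ring.
  by rewrite cos_neg sin_neg hc hs; case: (odd (a + e)) => /=; rewrite ?sgnN ?Ropp_0.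
have /sin_eq_0_0 [k] : sin (2 * ((h + 4 * t) * (PI / 2))) = 0%R.
  rewrite sin_2a; move: cs0; rewrite posE; case: hg => ->.
    by rewrite Rmult_1_l; lra.
  have -> : (-1 * ((h + 4 * t) * (PI / 2)) = - ((h + 4 * t) * (PI / 2)))%R by ring.
  by rewrite cos_neg sin_neg; lra.
move=> kE; have {}kE : (h + 4 * t = IZR k)%R.
  by apply: (Rmult_eq_reg_r PI); lra.
exists (Z.to_nat (k - up h)); rewrite /tick INR_IZR_INZ Z2Nat.id ?minus_IZR; first by
  rewrite /t0; lra.
suff : (up h < k + 1)%Z by lia.
by apply: lt_IZR; rewrite plus_IZR; lra.
Qed.

Lemma row_col_move s a e : row_move s a e = None <-> col_move a e <> None.
Proof. by rewrite /row_move /col_move; case: odd. Qed.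

Lemma grid_moveP s a e (u v : V) : v = grid_move s a e u /\ v <> u <->
  [\/ right_of u v /\ col_move a e = Some (odd u.2),
      right_of v u /\ col_move a e = Some (odd v.2),
      below u v /\ row_move s a e = Some (odd u.1) |
      below v u /\ row_move s a e = Some (odd v.1)].
Proof.
have movE : v = grid_move s a e u <->
    v.1 = slide n (row_move s a e) u.1 :> nat /\ v.2 = slide m (col_move a e) u.2 :> nat.
  split=> [-> //|[h1 h2]]; apply/eqP.
  by rewrite [v]surjective_pairing xpair_eqE -!val_eqE /= h1 h2 !eqxx.
have neE : v <> u <-> (v.1 <> u.1 :> nat) \/ (v.2 <> u.2 :> nat).
  split=> [ne|[ne vu|ne vu]]; [|by rewrite vu in ne..].
  have [h1|/eqP] := eqVneq (v.1 : nat) u.1; last by left.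
  have [h2|/eqP] := eqVneq (v.2 : nat) u.2; last by right.
  case: ne; apply/eqP.
  by rewrite [u]surjective_pairing [v]surjective_pairing xpair_eqE -!val_eqE /= h1 h2 !eqxx.
have rc := row_col_move s a e.
rewrite movE neE /right_of /below.
case hr: (row_move s a e) => [p|]; case hc: (col_move a e) => [q|].
- by have := proj2 rc; rewrite hr hc => /(_ ltac:(by [])).
- have sp := @slideP n p u.1 v.1 (ltn_ord _) (ltn_ord _).
  split=> [[[h1 h2] ne]|].
    have ne1 : v.1 <> u.1 :> nat by case: ne => // /(_ h2).
    have [[h <-]|[h <-]] := proj1 sp (conj h1 ne1); [apply: Or43|apply: Or44] => //.
  case=> -[[h1 h2]] // [hp].
    by have [? ?] := proj2 sp (or_introl (conj h1 (esym hp))); split; [|left].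
  by have [? ?] := proj2 sp (or_intror (conj h1 (esym hp))); split; [|left].
- have sp := @slideP m q u.2 v.2 (ltn_ord _) (ltn_ord _).
  split=> [[[h1 h2] ne]|].
    have ne2 : v.2 <> u.2 :> nat by case: ne => // /(_ h1).
    have [[h <-]|[h <-]] := proj1 sp (conj h2 ne2); [apply: Or41|apply: Or42] => //.
  case=> -[[h1 h2]] // [hp].
    by have [? ?] := proj2 sp (or_introl (conj h2 (esym hp))); split; [|right].
  by have [? ?] := proj2 sp (or_intror (conj h2 (esym hp))); split; [|right].
- by have := proj1 rc; rewrite hr hc => /(_ erefl).
Qed.

Lemma grid_activeP : exists (t0 : R) (s : bool) (a : nat), (0 < t0)%R /\
  forall t u v, (0 < t)%R -> active (@grid_adj n m) phi f g t u v <->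
    exists e, [/\ t = tick t0 e, v = grid_move s a e u & v <> u].
Proof.
have [t0 [s [a [t0_gt0 [val zero]]]]] := clock.
exists t0, s, a; split=> // t u v t_gt0.
have cosE e p : cos (angle o (tick t0 e)) = sgn p <-> col_move a e = Some p.
  have [-> _] := val e; rewrite /col_move; case: (odd (a + e)).
    by split=> // h; case: (@sgn_neq0 p).
  by split=> [/sgn_inj ->|[->]].
have sinE e p : sin (angle o (tick t0 e)) = sgn (~~ p) <-> row_move s a e = Some p.
  have [_ ->] := val e; rewrite /row_move; case: (odd (a + e)).
    by split=> [/sgn_inj ->|[<-]]; rewrite negbK.
  by split=> // h; case: (@sgn_neq0 (~~ p)).
have activeE e : active (@grid_adj n m) phi f g (tick t0 e) u v <->
    v = grid_move s a e u /\ v <> u.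
  rewrite grid_moveP; split=> [act|].
    have [auv _] := act; case/grid_adjP: auv => uv.
    - by apply: Or41; split=> //; apply/cosE/(proj1 (active_right _ uv)).
    - by apply: Or42; split=> //; apply/cosE/(proj2 (active_right _ uv)).
    - by apply: Or43; split=> //; apply/sinE/(proj1 (active_below _ uv)).
    - by apply: Or44; split=> //; apply/sinE/(proj2 (active_below _ uv)).
  by case=> -[uv]; [move/cosE|move/cosE|move/sinE|move/sinE];
    [move/(proj1 (active_right _ uv))|move/(proj2 (active_right _ uv))
    |move/(proj1 (active_below _ uv))|move/(proj2 (active_below _ uv))].
split=> [act|[e [-> hv ne]]]; last by apply/activeE.
(* An active link puts the cosine or the sine of the corner robot at 1 or -1, so the other one
   vanishes and [t] is a tick. *)
suff /(zero _ t_gt0) [e te] : (cos (angle o t) * sin (angle o t) = 0)%R.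
  by exists e; subst t; have [] := (proj1 (activeE e) act).
have unit_zero x y p : (x * x + y * y)%R = 1%R -> x = sgn p -> y = 0%R.
  move=> xy xp; have x2 : (x * x = 1)%R by rewrite xp; case: (p); rewrite /sgn; ring.
  by apply: Rsqr_0_uniq; rewrite /Rsqr; lra.
have unit := sin2_cos2 (angle o t); rewrite /Rsqr in unit.
have unit' := unit; rewrite Rplus_comm in unit'.
have [auv _] := act; case/grid_adjP: auv => uv.
- by rewrite (unit_zero _ _ _ unit' (proj1 (proj1 (active_right t uv)) act)); ring.
- by rewrite (unit_zero _ _ _ unit' (proj1 (proj2 (active_right t uv)) act)); ring.
- by rewrite (unit_zero _ _ _ unit (proj1 (proj1 (active_below t uv)) act)); ring.
- by rewrite (unit_zero _ _ _ unit (proj1 (proj2 (active_below t uv)) act)); ring.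
Qed.
End Clockwork.

(** * Rook placements *)

Section GridMoves.
Variables (n m : nat) (s : bool) (a : nat).
Local Notation V := ('I_n * 'I_m)%type.
Local Notation move := (@grid_move n m s a).

Lemma alternating_col : alternating (col_move a).
Proof.
move=> e; rewrite /col_move !addnS /= negbK uphalf_half.
by case: (odd (a + e)).
Qed.

Lemma alternating_row : alternating (row_move s a).
Proof.
move=> e; rewrite /row_move !addnS /= negbK.
by case: (odd (a + e)) => //; rewrite addbN.
Qed.

Lemma flow_row E T (u : V) : (flow move E T u).1 = track n (row_move s a) E T u.1 :> nat.
Proof. by elim: T => //= T ->. Qed.

Lemma flow_col E T (u : V) : (flow move E T u).2 = track m (col_move a) E T u.2 :> nat.
Proof. by elim: T => //= T ->. Qed.

(** Slots sharing a row share it forever, and their columns cross by [slides_meet]. At that event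
    the rows pause, so [move] carries one slot onto the other. The case of a shared column is
    alike. *)
Lemma grid_meet E (u w : V) : u <> w -> u.1 = w.1 \/ u.2 = w.2 ->
  exists T, move (E + T) (flow move E T u) = flow move E T w.
Proof.
case: u w => [i j] [i' j'] ne /= [eq1|eq2].
  have nej : j <> j' :> nat by move=> /val_inj eq2; apply: ne; rewrite eq1 eq2.
  have [T [cT meet]] := slides_meet E alternating_col (ltn_ord j) (ltn_ord j') nej.
  exists T; apply/eqP; rewrite [flow _ _ _ (i', j')]surjective_pairing xpair_eqE -!val_eqE /=.
  rewrite !flow_row !flow_col /= eq1 meet eqxx andbT.
  by rewrite (proj2 (row_col_move s a (E + T)) cT).
have nei : i <> i' :> nat by move=> /val_inj eq1; apply: ne; rewrite eq1 eq2.
have [T [rT meet]] := slides_meet E alternating_row (ltn_ord i) (ltn_ord i') nei.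
exists T; apply/eqP; rewrite [flow _ _ _ (i', j')]surjective_pairing xpair_eqE -!val_eqE /=.
rewrite !flow_row !flow_col /= eq2 meet eqxx /=.
case cT: (col_move a (E + T)) => [p|] //=.
by case: rT; apply/row_col_move; rewrite cT.
Qed.

Lemma origin_row e (u w : V) : u.1 = w.1 -> (origin move e u).1 = (origin move e w).1.
Proof. by elim: e u w => //= e IH u w uw; apply: IH; rewrite /= uw. Qed.

Lemma origin_col e (u w : V) : u.2 = w.2 -> (origin move e u).2 = (origin move e w).2.
Proof. by elim: e u w => //= e IH u w uw; apply: IH; rewrite /= uw. Qed.

Lemma grid_move_line e (u : V) : (move e u).1 = u.1 \/ (move e u).2 = u.2.
Proof.
case cT: (col_move a e) => [p|]; [left|right]; apply: val_inj => /=; last by rewrite cT.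
by rewrite (proj2 (row_col_move s a e)) // cT.
Qed.

End GridMoves.

Lemma pigeonhole (T T' : finType) (A : {set T}) (h : T -> T') : #|T'| < #|A| ->
  exists u w, [/\ u \in A, w \in A, u <> w & h u = h w].
Proof.
move=> lt; have : ~~ dinjectiveb h (mem A).
  by apply/negP => /dinjectiveP /leq_card_in; rewrite leqNgt lt.
case/dinjectivePn => u uA [w]; rewrite !inE => /andP [/eqP wu wA] uw.
by exists u, w; split=> // uw'; apply: wu.
Qed.

(** A rook placement with [x] cells for any [x] up to the minimum, since every larger number of
    departures has to be refuted. *)
Definition diagonal n m x : {set 'I_n * 'I_m} :=
  [set u : 'I_n * 'I_m | (u.1 == u.2 :> nat) && (u.1 < x)].

Lemma card_diagonal n m x : x <= minn n m -> #|diagonal n m x| = x.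
Proof.
rewrite leq_min => /andP [xn xm].
have -> : diagonal n m x = (fun i : 'I_x => (widen_ord xn i, widen_ord xm i)) @: 'I_x.
  apply/setP => -[i j]; rewrite inE /=; apply/andP/imsetP => [[/eqP ij ix]|[k _ [-> ->]] //=].
  by exists (Ordinal ix) => //; congr pair; apply: val_inj.
by rewrite card_imset ?card_ord // => i j [/val_inj].
Qed.

Lemma diagonal_rook n m x (u w : 'I_n * 'I_m) : u \in diagonal n m x -> w \in diagonal n m x ->
  u.1 = w.1 \/ u.2 = w.2 -> u = w.
Proof.
case: u w => [i j] [i' j']; rewrite !inE /= => /andP [/eqP ij _] /andP [/eqP ij' _] h.
by congr pair; apply: val_inj => /=; case: h => h; move: ij ij'; rewrite h; lia.
Qed.

Theorem theorem11 (n m : nat) (hn : (0 < n)%nat) (hm : (0 < m)%nat)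
  (dd r : R) (hdd : (2 < dd)%R) (hr : (0 < r)%R)
  (hcomm : forall u v : 'I_n * 'I_m, u != v ->
     (grid_adj u v <-> (eucl_dist (grid_center dd u) (grid_center dd v) <= 2 + r)%R))
  (phi : 'I_n * 'I_m -> 'I_n * 'I_m -> R)
  (hphi : forall u v, grid_adj u v ->
     link_angle (grid_center dd u) (grid_center dd v) (phi u v))
  (f g : 'I_n * 'I_m -> R)
  (hF : sync_schedule (@grid_adj n m) phi f g) :
  isolation_resilience_is (@grid_adj n m) phi f g
    (Z.of_nat (n * m) - Z.of_nat (minn n m) - 1)%Z.
Proof.
pose o : 'I_n * 'I_m := (Ordinal hn, Ordinal hm).
have dd_gt0 : (0 < dd)%R by lra.
have [t0 [s [a [t0_gt0 act]]]] :=
  @grid_activeP n m dd phi f g o erefl erefl dd_gt0 hphi hF.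
have moveK := @grid_moveK n m s a.
have move_inj e : injective (@grid_move n m s a e) := inv_inj (moveK e).
have cardV : #|{: 'I_n * 'I_m}| = n * m by rewrite card_prod !card_ord.
have min_mul : minn n m <= n * m by nia.
split=> [k_ge0 S cardS d d_gt0 st run starve|j lt_j le_j].
  have [E [slot [slot_inj apart]]] := starved_slots t0_gt0 moveK act d_gt0 run starve.
  have cardA : minn n m < #|~: S| by have := cardsC S; rewrite cardV cardS; lia.
  (* More than min(n, m) robots survive, so projecting slots to the shorter family of lines puts two
     on one line. *)
  have [u [w [uS wS uw line]]] : exists u w, [/\ u \in ~: S, w \in ~: S, u <> w &
      (slot u).1 = (slot w).1 \/ (slot u).2 = (slot w).2].
    have [le_nm|lt_mn] := leqP n m.
      have [|u [w [? ? ? ?]]] := @pigeonhole _ _ (~: S) (fun u => (slot u).1).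
        by rewrite card_ord; lia.
      by exists u, w; split=> //; left.
    have [|u [w [? ? ? ?]]] := @pigeonhole _ _ (~: S) (fun u => (slot u).2).
      by rewrite card_ord; lia.
    by exists u, w; split=> //; right.
  have ne : slot u <> slot w by move/slot_inj => /(_ uS wS).
  have [T meet] := grid_meet s a E ne line.
  (* Their meeting forces the flows to coincide, but the flow is injective. *)
  apply: ne; apply: (flow_inj move_inj (E := E) (T := T)).
  by apply: apart => //; rewrite -in_setC.
rewrite cardV in le_j.
have x_le : n * m - j <= minn n m by lia.
have -> : j = #|~: diagonal n m (n * m - j)|.
  by have := cardsC (diagonal n m (n * m - j)); rewrite cardV card_diagonal //; lia.
(* If [v] and its partner both originate on the diagonal, their origins share a line, hence
   coincide, and so do [v] and the partner. *)
apply: (not_resilient_free t0_gt0 act) => e v ov ow.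
apply: (origin_inj (e := e) move_inj); apply: diagonal_rook ow ov _.
by case: (grid_move_line s a e v) => h; [left; apply: origin_row|right; apply: origin_col].
Qed.
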